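(* Let $\lambda$ be a nonzero real number, $k$ a nonnegative integer and $\alpha$ a real number. For every $n\ge0$, $$\beta_{n,\lambda}^{(k)}=\sum_{l=0}^{n}\binom{l+k}{k}^{-1}S_{1,\lambda}(l+k,k)\,S_{2,\lambda}(n,l),\qquad \mathcal{E}_{n,\lambda}^{(\alpha)}=\sum_{l=0}^{n}\left(-\frac{1}{2}\right)^{l}\binom{\alpha+l-1}{l}l!\,S_{2,\lambda}(n,l).$$
   Context: For a nonzero real $\lambda$: $(x)_{0,\lambda}=1$, $(x)_{n,\lambda}=x(x-\lambda)\cdots(x-(n-1)\lambda)$; $(x)_n=(x)_{n,1}$; $e_\lambda(t)=(1+\lambda t)^{1/\lambda}$. Degenerate Stirling numbers: $(x)_n=\sum_{l=0}^{n}S_{1,\lambda}(n,l)(x)_{l,\lambda}$ and $(x)_{n,\lambda}=\sum_{k=0}^{n}S_{2,\lambda}(n,k)(x)_{k}$. The higher-order degenerate Bernoulli numbers $\beta^{(k)}_{n,\lambda}$ and Euler numbers $\mathcal{E}^{(\alpha)}_{n,\lambda}$ are defined by $\left(\frac{t}{e_\lambda(t)-1}\right)^{k}=\sum_{n\ge0}\beta^{(k)}_{n,\lambda}\frac{t^n}{n!}$ and $\left(\frac{2}{e_\lambda(t)+1}\right)^{\alpha}=\sum_{n\ge0}\mathcal{E}^{(\alpha)}_{n,\lambda}\frac{t^n}{n!}$. $\binom{\alpha+l-1}{l}$ is the generalized binomial coefficient. *)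

(* Defs.v *)
From Stdlib Require Import Arith Reals ClassicalEpsilon.
From Coquelicot Require Import Coquelicot.
Open Scope R_scope.

(* (x)_{n,lam} = x (x - lam) ... (x - (n-1) lam); the usual falling factorial
   (x)_n is [dfall 1 x n]. *)
Fixpoint dfall (lam x : R) (n : nat) : R :=
  match n with
  | O => 1
  | S m => dfall lam x m * (x - INR m * lam)
  end.

Definition gbinom (x : R) (l : nat) : R := dfall 1 x l / INR (fact l).

(* e_lam(t) = (1 + lam t)^(1/lam), meaningful where 1 + lam t > 0, hence for
   all t near 0. *)
Definition dexp (lam t : R) : R := Rpower (1 + lam * t) (1 / lam).

(* [c n l], 0 <= l <= n, are the coefficients of [p _ n] on the family [q];
   the array is extended by 0 above the diagonal. *)
Definition is_connection (p q : R -> nat -> R) (c : nat -> nat -> R) : Prop :=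
  (forall (n : nat) (x : R), p x n = sum_f_R0 (fun l => c n l * q x l) n) /\
  (forall n l : nat, (n < l)%nat -> c n l = 0).

Definition connection (p q : R -> nat -> R) : nat -> nat -> R :=
  epsilon (inhabits (fun _ _ => 0)) (is_connection p q).

Definition S1 (lam : R) : nat -> nat -> R := connection (dfall 1) (dfall lam).
Definition S2 (lam : R) : nat -> nat -> R := connection (dfall lam) (dfall 1).

(* f(t) = sum_n a_n t^n / n! as a convergent series near 0. The point t = 0 is
   left out because t / (e_lam(t) - 1) has a removable singularity there. *)
Definition is_egf (f : R -> R) (a : nat -> R) : Prop :=
  locally' 0 (fun t => is_pseries (fun n => a n / INR (fact n)) t (f t)).

Definition egf_coef (f : R -> R) : nat -> R :=
  epsilon (inhabits (fun _ => 0)) (is_egf f).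

Definition dbernoulli (lam : R) (k n : nat) : R :=
  egf_coef (fun t => (t / (dexp lam t - 1)) ^ k) n.

Definition deuler (lam alpha : R) (n : nat) : R :=
  egf_coef (fun t => Rpower (2 / (dexp lam t + 1)) alpha) n.

(* Main.v *)
Require Import Defs.
From Stdlib Require Import Arith Reals Lra Lia ClassicalEpsilon.
From Coquelicot Require Import Coquelicot.
Open Scope R_scope.

(** Put [u = e_lam(t) - 1].  Inverting, [t = ((1 + u)^lam - 1) / lam], so both
    generating functions are power series in [u]: [(t / u)^k] because [t^k / k!]
    has the coefficients [S1 lam n k / n!] in [u], and
    [(2 / (u + 2))^alpha = (1 + u/2)^(-alpha)] by the binomial series.  Since
    [u^l / l! = sum_n S2 lam n l t^n / n!], substitution gives both formulas.
    The two kinds of Stirling numbers are treated at once: for the connection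
    coefficients [c] from [(x)_{n,a}] to [(x)_{l,b}] the recurrence of [c] says
    that [k! sum_n c n k t^n / n!] solves the same first-order linear equation
    as [g^k], where [g = ((1 + a t)^(b/a) - 1) / b]. *)

(** * Radii of convergence and uniqueness of exponential generating functions *)

Lemma sum_f_R0_zero (f : nat -> R) (n : nat) :
  (forall i, (i <= n)%nat -> f i = 0) -> sum_f_R0 f n = 0.
Proof.
  intros H. rewrite (sum_eq f (fun _ => 0) n H), sum_cte. ring.
Qed.

(** At the point [/ r] all terms are bounded by [B], so the radius is at least [/ r]. *)
Lemma CV_radius_geometric (a : nat -> R) (B r t : R) :
  0 < r -> (forall n, Rabs (a n) <= B * r ^ n) -> Rabs t * r < 1 ->
  Rbar_lt (Rabs t) (CV_radius a).
Proof.
  intros Hr Ha Ht.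
  apply Rbar_lt_le_trans with (Finite (/ r)).
  - simpl. apply (Rmult_lt_reg_r r); [exact Hr|]. rewrite Rinv_l; lra.
  - apply (CV_radius_bounded a). exists B. intros n.
    rewrite Rabs_mult, <- RPow_abs, Rabs_inv, (Rabs_right r) by lra.
    rewrite pow_inv.
    assert (Hrn : 0 < r ^ n) by (apply pow_lt; exact Hr).
    apply (Rmult_le_reg_r (r ^ n)); [exact Hrn|].
    rewrite Rmult_assoc, Rinv_l, Rmult_1_r by lra. apply Ha.
Qed.

(** The terms of a convergent series tend to 0, which fails outside the disk of convergence; hence
    the radius is at least [Rabs t]. *)
Lemma CV_radius_pos (a : nat -> R) (t s : R) :
  t <> 0 -> is_pseries a t s -> Rbar_lt 0 (CV_radius a).
Proof.
  intros Ht Hs. apply Rbar_lt_le_trans with (Finite (Rabs t)).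
  - simpl. now apply Rabs_pos_lt.
  - apply Rbar_not_lt_le. intros Hlt.
    apply (CV_disk_outside a t Hlt), ex_series_lim_0.
    exists s. now apply is_pseries_R.
Qed.

Lemma locally'_0_point (P : R -> Prop) (d : posreal) :
  locally' 0 P -> exists t, 0 < t < d /\ P t.
Proof.
  intros [e He]. exists (Rmin d e / 2).
  pose proof (cond_pos d). pose proof (cond_pos e).
  assert (0 < Rmin d e) by (now apply Rmin_pos).
  pose proof (Rmin_l d e). pose proof (Rmin_r d e).
  split; [lra|]. apply He; [|lra].
  unfold ball; simpl; unfold AbsRing_ball, abs, minus, plus, opp; simpl.
  rewrite Rabs_right; lra.
Qed.

(** Both values are the limit from the right of the same function. This recovers the point 0, which
    [is_egf] leaves out. *)
Lemma eq_limit_0 (f g : R -> R) :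
  continuity_pt f 0 -> continuity_pt g 0 -> locally' 0 (fun t => f t = g t) ->
  f 0 = g 0.
Proof.
  intros Hf Hg H. apply continuity_pt_filterlim in Hf, Hg.
  apply (filterlim_locally_unique (F := at_right 0) f).
  - apply filterlim_filter_le_1 with (2 := Hf). apply filter_le_within.
  - apply filterlim_ext_loc with g.
    + destruct H as [d Hd]. exists d. intros t Ht Hpos. symmetry.
      apply Hd; [exact Ht|lra].
    + apply filterlim_filter_le_1 with (2 := Hg). apply filter_le_within.
Qed.

(** Each series converges at some nonzero point, so both radii are positive, and equality of the
    sums near 0 determines the coefficients. Thus the choice made by [epsilon] in [egf_coef] is
    forced as soon as one expansion is known. *)
Lemma egf_unique (f : R -> R) (a b : nat -> R) :
  is_egf f a -> is_egf f b -> forall n, a n = b n.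
Proof.
  intros Ha Hb n.
  assert (Hpos : forall c, is_egf f c ->
            Rbar_lt 0 (CV_radius (fun n => c n / INR (fact n)))).
  { intros c Hc.
    destruct (locally'_0_point _ (mkposreal 1 Rlt_0_1) Hc) as [t [Ht Hs]].
    apply CV_radius_pos with (2 := Hs). lra. }
  pose proof (Hpos a Ha) as Ra. pose proof (Hpos b Hb) as Rb.
  assert (E : locally' 0 (fun t => PSeries (fun n => a n / INR (fact n)) t
                              = PSeries (fun n => b n / INR (fact n)) t)).
  { generalize (filter_and _ _ Ha Hb). apply filter_imp.
    intros t [H1 H2].
    now rewrite (is_pseries_unique _ _ _ H1), (is_pseries_unique _ _ _ H2). }
  (* Comparing coefficients needs equality on a full neighbourhood; the missing point 0 is filled by
     continuity. *)
  assert (E0 : PSeries (fun n => a n / INR (fact n)) 0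
             = PSeries (fun n => b n / INR (fact n)) 0).
  { apply eq_limit_0; [| |exact E];
      apply PSeries_continuity; now rewrite Rabs_R0. }
  assert (H : a n / INR (fact n) = b n / INR (fact n)).
  { apply (PSeries_ext_recip (fun n => a n / INR (fact n)) (fun n => b n / INR (fact n)) n Ra Rb).
    unfold locally', within in E. revert E. apply filter_imp.
    intros t Ht. destruct (Req_dec t 0) as [->|Hn]; [exact E0|now apply Ht]. }
  pose proof (INR_fact_neq_0 n).
  apply (Rmult_eq_reg_r (/ INR (fact n))); [exact H|now apply Rinv_neq_0_compat].
Qed.

Lemma egf_coef_eq (f : R -> R) (a : nat -> R) :
  is_egf f a -> forall n, egf_coef f n = a n.
Proof.
  intros Ha. apply egf_unique with f; [|exact Ha].
  unfold egf_coef. apply epsilon_spec. now exists a.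
Qed.

(** * Substitution into a power series and division by a power of the variable *)

Lemma is_pseries_tail (a : nat -> R) (B q t s : R) (N : nat) :
  0 <= q < 1 -> (forall n, Rabs (a n * t ^ n) <= B * q ^ n) -> is_pseries a t s ->
  Rabs (s - sum_f_R0 (fun n => a n * t ^ n) N) <= B * (q ^ S N / (1 - q)).
Proof.
  intros Hq Ha Hs.
  set (u := fun n => a n * t ^ n) in *.
  change (forall n, Rabs (u n) <= B * q ^ n) in Ha.
  assert (HB : 0 <= B).
  { specialize (Ha 0%nat). rewrite pow_O in Ha. pose proof (Rabs_pos (u 0%nat)). lra. }
  assert (Hp : forall n, 0 <= q ^ n) by (intros; apply pow_le; lra).
  (* The bound is [B] times the closed form of the geometric sum from [q ^ S N] to [q ^ (m + N)];
     afterwards [m] tends to infinity. *)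
  assert (Hm : forall m, Rabs (sum_f_R0 u (m + N) - sum_f_R0 u N)
               <= B * ((q ^ S N - q ^ S (m + N)) / (1 - q))).
  { induction m as [|m IH].
    - simpl Init.Nat.add. rewrite !Rminus_diag, Rabs_R0. unfold Rdiv. rewrite Rmult_0_l, Rmult_0_r. lra.
    - replace (S m + N)%nat with (S (m + N)) by lia. rewrite tech5.
      replace (sum_f_R0 u (m + N) + u (S (m + N)) - sum_f_R0 u N)
        with ((sum_f_R0 u (m + N) - sum_f_R0 u N) + u (S (m + N))) by ring.
      eapply Rle_trans; [apply Rabs_triang|].
      eapply Rle_trans; [apply Rplus_le_compat; [exact IH|apply Ha]|].
      apply Req_le. simpl. field. lra. }
  assert (Hl : is_lim_seq (fun m => Rabs (sum_f_R0 u (m + N) - sum_f_R0 u N))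
                 (Rabs (s - sum_f_R0 u N))).
  { apply (is_lim_seq_abs _ (Finite (s - sum_f_R0 u N))).
    apply is_lim_seq_minus'; [|apply is_lim_seq_const].
    apply (is_lim_seq_incr_n (fun m => sum_f_R0 u m) N).
    apply is_pseries_R in Hs.
    apply is_lim_seq_ext with (sum_n u); [intros; apply sum_n_Reals|exact Hs]. }
  refine (is_lim_seq_le _ _ (Finite _) (Finite _) _ Hl (is_lim_seq_const _)).
  intros m. eapply Rle_trans; [apply Hm|].
  apply Rmult_le_compat_l; [exact HB|].
  unfold Rdiv. apply Rmult_le_compat_r; [left; apply Rinv_0_lt_compat; lra|].
  pose proof (Hp (S (m + N))). lra.
Qed.

(** A finite interchange: the pairs with [n < l], absent on the left, contribute 0 on the right. *)
Lemma sum_triangle (a : nat -> R) (e : nat -> nat -> R) (t : R) (N : nat) :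
  (forall l n, (n < l)%nat -> e l n = 0) ->
  sum_f_R0 (fun n => sum_f_R0 (fun l => a l * e l n) n * t ^ n) N
  = sum_f_R0 (fun l => a l * sum_f_R0 (fun n => e l n * t ^ n) N) N.
Proof.
  intros He. induction N as [|N IH]; [simpl; ring|].
  rewrite tech5, IH.
  rewrite (tech5 (fun l => a l * sum_f_R0 (fun n => e l n * t ^ n) (S N)) N).
  rewrite (tech5 (fun n => e (S N) n * t ^ n) N).
  rewrite (sum_f_R0_zero (fun n => e (S N) n * t ^ n) N)
    by (intros i Hi; rewrite He by lia; ring).
  rewrite (sum_eq (fun l => a l * sum_f_R0 (fun n => e l n * t ^ n) (S N))
    (fun l => a l * sum_f_R0 (fun n => e l n * t ^ n) N
              + a l * e l (S N) * t ^ S N))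
    by (intros i _; rewrite tech5; ring).
  rewrite plus_sum, (tech5 (fun l => a l * e l (S N)) N).
  rewrite <- (scal_sum (fun l => a l * e l (S N)) N (t ^ S N)).
  ring.
Qed.

(* Swapping the two sums over [0..N] leaves only the tails of the inner series;
   they are at most [M ^ l * O(q ^ N)], and [sum |a_l| M ^ l] converges. *)
Lemma is_pseries_comp (a : nat -> R) (e : nat -> nat -> R) (A r M Q t v s : R) :
  0 < r -> 0 < M -> 0 < Q -> r * M <= 1 / 2 -> Rabs t * Q < 1 ->
  (forall l, Rabs (a l) <= A * r ^ l) ->
  (forall l n, Rabs (e l n) <= M ^ l * Q ^ n) ->
  (forall l n, (n < l)%nat -> e l n = 0) ->
  (forall l, is_pseries (e l) t (v ^ l)) ->
  is_pseries a v s ->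
  is_pseries (fun n => sum_f_R0 (fun l => a l * e l n) n) t s.
Proof.
  intros Hr HM HQ HrM Ht Ha He He0 Hv Hs.
  set (q := Rabs t * Q) in *.
  assert (Hq : 0 <= q < 1).
  { split; [|exact Ht]. apply Rmult_le_pos; [apply Rabs_pos|lra]. }
  assert (HA : 0 <= A).
  { pose proof (Ha 0%nat) as H. simpl in H. pose proof (Rabs_pos (a 0%nat)). lra. }
  apply is_pseries_R.
  assert (Hd : forall N,
    Rabs (sum_f_R0 (fun l => a l * v ^ l) N
          - sum_f_R0 (fun n => sum_f_R0 (fun l => a l * e l n) n * t ^ n) N)
    <= 2 * A * (q ^ S N / (1 - q))).
  { intros N. rewrite sum_triangle by exact He0.
    rewrite <- minus_sum.
    eapply Rle_trans; [apply Rsum_abs|].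
    assert (Hqn : 0 <= q ^ S N / (1 - q)).
    { apply Rmult_le_pos; [apply pow_le; lra|left; apply Rinv_0_lt_compat; lra]. }
    (* The condition [r * M <= 1 / 2] gives the weights [(1 / 2) ^ l], whose sum is below 2; this is
       the 2 in [Hd]. *)
    apply Rle_trans with
      (sum_f_R0 (fun l => (1 / 2) ^ l * (A * (q ^ S N / (1 - q)))) N).
    - apply sum_Rle. intros l _. rewrite <- Rmult_minus_distr_l, Rabs_mult.
      apply Rle_trans with ((A * r ^ l) * (M ^ l * (q ^ S N / (1 - q)))).
      + apply Rmult_le_compat; [apply Rabs_pos|apply Rabs_pos|apply Ha|].
        apply is_pseries_tail; [exact Hq| |apply Hv].
        intros n. rewrite Rabs_mult, <- RPow_abs. unfold q. rewrite Rpow_mult_distr.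
        replace (M ^ l * (Rabs t ^ n * Q ^ n))
          with (M ^ l * Q ^ n * Rabs t ^ n) by ring.
        apply Rmult_le_compat_r; [apply pow_le, Rabs_pos|apply He].
      + replace (A * r ^ l * (M ^ l * (q ^ S N / (1 - q))))
          with ((r * M) ^ l * (A * (q ^ S N / (1 - q))))
          by (rewrite Rpow_mult_distr; ring).
        apply Rmult_le_compat_r; [now apply Rmult_le_pos|].
        apply pow_incr. split; [apply Rmult_le_pos; lra|exact HrM].
    - rewrite <- scal_sum, tech3 by lra.
      replace (2 * A * (q ^ S N / (1 - q)))
        with ((A * (q ^ S N / (1 - q))) * 2) by ring.
      apply Rmult_le_compat_l; [now apply Rmult_le_pos|].
      assert (0 < (1 / 2) ^ S N) by (apply pow_lt; lra). lra. }
  assert (L : is_lim_seq (fun N => sum_f_R0 (fun l => a l * v ^ l) N) s).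
  { apply is_pseries_R in Hs.
    apply is_lim_seq_ext with (sum_n (fun l => a l * v ^ l));
      [intros; apply sum_n_Reals|exact Hs]. }
  assert (Z : is_lim_seq (fun N => 2 * A * (q ^ S N / (1 - q))) 0).
  { replace (Finite 0) with (Finite (2 * A * (0 / (1 - q)))) by (f_equal; field; lra).
    apply (is_lim_seq_scal_l _ (2 * A) (Finite (0 / (1 - q)))).
    apply (is_lim_seq_scal_r _ (/ (1 - q)) (Finite 0)).
    apply (is_lim_seq_incr_1 (fun N => q ^ N)).
    apply is_lim_seq_geom. rewrite Rabs_right; lra. }
  assert (D : is_lim_seq (fun N => sum_f_R0 (fun l => a l * v ^ l) N
     - sum_f_R0 (fun n => sum_f_R0 (fun l => a l * e l n) n * t ^ n) N) 0).
  { apply is_lim_seq_abs_0.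
    refine (is_lim_seq_le_le (fun _ => 0) _ _ 0 _ (is_lim_seq_const 0) Z).
    intros N; split; [apply Rabs_pos|apply Hd]. }
  change (is_lim_seq (sum_n (fun n => sum_f_R0 (fun l => a l * e l n) n * t ^ n)) s).
  pose proof (is_lim_seq_minus' _ _ _ _ L D) as F.
  rewrite Rminus_0_r in F.
  refine (is_lim_seq_ext _ _ _ _ F).
  intros N. rewrite sum_n_Reals. simpl. ring.
Qed.

(** Each induction step removes one vanishing leading coefficient and divides by [t] once. *)
Lemma is_pseries_shift (a : nat -> R) (k : nat) (t s : R) :
  t <> 0 -> (forall n, (n < k)%nat -> a n = 0) -> is_pseries a t s ->
  is_pseries (fun n => a (n + k)%nat) t (s / t ^ k).
Proof.
  intros Ht. induction k as [|k IH]; intros Ha Hs.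
  - simpl. unfold Rdiv. rewrite Rinv_1, Rmult_1_r.
    apply (is_pseries_ext a); [intros n; f_equal; lia|exact Hs].
  - assert (H : is_pseries (fun n => a (n + k)%nat) t (s / t ^ k))
      by (apply IH; [intros; apply Ha; lia|exact Hs]).
    apply (is_pseries_decr_1 _ t (/ t)) in H; [|now apply Rinv_l].
    apply (is_pseries_ext _ (fun n => a (n + S k)%nat)) in H.
    2: { intros n. unfold PS_decr_1. f_equal; lia. }
    replace (s / t ^ S k) with
      (scal (/ t) (plus (s / t ^ k) (opp (a (0 + k)%nat)))); [exact H|].
    rewrite Ha by lia. unfold scal, plus, opp; simpl. unfold mult; simpl.
    field. split; [now apply pow_nonzero|exact Ht].
Qed.

(** * A first-order linear equation and the binomial series *)

Lemma Rpower_base_1 (x : R) : Rpower 1 x = 1.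
Proof. unfold Rpower. now rewrite ln_1, Rmult_0_r, exp_0. Qed.

(** Turns an equation for [(1 + a t) y'] into a recurrence on the coefficients of [y]. *)
Lemma PSeries_affine_derive (e : nat -> R) (a t : R) :
  Rbar_lt (Rabs t) (CV_radius e) ->
  (1 + a * t) * PSeries (PS_derive e) t
  = PSeries (fun n => INR (S n) * e (S n) + a * (INR n * e n)) t.
Proof.
  intros Ht.
  assert (Hd : ex_pseries (PS_derive e) t)
    by (apply CV_radius_inside; now rewrite CV_radius_derive).
  rewrite (PSeries_ext (fun n => INR (S n) * e (S n) + a * (INR n * e n))
             (PS_plus (PS_derive e) (PS_scal a (PS_incr_1 (PS_derive e))))).
  - rewrite PSeries_plus, PSeries_scal, PSeries_incr_1; [ring|exact Hd|].
    apply ex_pseries_scal; [apply Rmult_comm|now apply ex_pseries_incr_1].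
  - intros n. unfold PS_plus, PS_scal, PS_incr_1, PS_derive.
    unfold plus, scal, zero; simpl; unfold mult; simpl.
    destruct n; simpl; ring.
Qed.

Lemma affine_pos (a r s : R) : Rabs a <= r -> Rabs s * r < 1 -> 0 < 1 + a * s.
Proof.
  intros Ha Hs.
  assert (H : Rabs (a * s) < 1).
  { rewrite Rabs_mult, Rmult_comm. eapply Rle_lt_trans; [|exact Hs].
    apply Rmult_le_compat_l; [apply Rabs_pos|exact Ha]. }
  apply Rabs_def2 in H. lra.
Qed.

Lemma is_derive_Rpower_affine (a p s : R) : 0 < 1 + a * s ->
  is_derive (fun s => Rpower (1 + a * s) p) s
    (p * a / (1 + a * s) * Rpower (1 + a * s) p).
Proof.
  intros H. unfold Rpower. auto_derive; [lra|]. field. lra.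
Qed.

(** Integrating factor: the product of [H s] and [(1 + a s)^(-c/a)] has derivative 0 between 0 and
    [t], hence is constant there. *)
Lemma affine_ode_unique (H H' : R -> R) (a c t : R) :
  a <> 0 ->
  (forall s, Rabs s <= Rabs t -> 0 < 1 + a * s) ->
  (forall s, Rabs s <= Rabs t -> is_derive H s (H' s)) ->
  (forall s, Rabs s <= Rabs t -> (1 + a * s) * H' s = c * H s) ->
  H t = H 0 * Rpower (1 + a * t) (c / a).
Proof.
  intros Ha Hpos Hder Hode.
  set (K := fun s => H s * Rpower (1 + a * s) (- (c / a))).
  assert (HK : forall s, Rabs s <= Rabs t -> is_derive K s zero).
  { intros s Hs. specialize (Hpos s Hs). specialize (Hder s Hs).
    specialize (Hode s Hs).
    pose proof (is_derive_mult H _ s _ _ Hder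
                  (is_derive_Rpower_affine a (- (c / a)) s Hpos) Rmult_comm) as D.
    refine (eq_ind _ (is_derive K s) D _ _).
    unfold plus, mult, zero; simpl.
    replace (H' s) with (c * H s / (1 + a * s)) by (rewrite <- Hode; field; lra).
    field. lra. }
  assert (HK0 : K t = K 0).
  { destruct (Rtotal_order t 0) as [Hlt|[->|Hgt]]; [|reflexivity|].
    - apply (eq_is_derive K); [|exact Hlt].
      intros s Hs. apply HK. rewrite !Rabs_left1; lra.
    - symmetry. apply (eq_is_derive K); [|exact Hgt].
      intros s Hs. apply HK. rewrite !Rabs_right; lra. }
  unfold K in HK0.
  rewrite Rmult_0_r, Rplus_0_r in HK0.
  rewrite Rpower_base_1, Rmult_1_r in HK0.
  rewrite <- HK0, Rmult_assoc, <- Rpower_plus.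
  replace (- (c / a) + c / a) with 0 by ring.
  rewrite Rpower_O by (apply Hpos; lra). ring.
Qed.

(** The ratio of consecutive terms is [(b - n a) / (n + 1)], at most [Rabs a + Rabs b] in absolute
    value. The factor 1 fits the shape [B * r ^ n] of the geometric bounds. *)
Lemma dfall_fact_bound (a b : R) (n : nat) :
  Rabs (dfall a b n / INR (fact n)) <= 1 * (1 + Rabs a + Rabs b) ^ n.
Proof.
  rewrite Rmult_1_l. induction n as [|n IH].
  - simpl. rewrite Rdiv_1_r, Rabs_R1. lra.
  - pose proof (pos_INR n) as Hn. pose proof (INR_fact_neq_0 n) as Hf.
    pose proof (Rabs_pos a) as Pa. pose proof (Rabs_pos b) as Pb.
    replace (dfall a b (S n) / INR (fact (S n)))
      with (dfall a b n / INR (fact n) * ((b - INR n * a) / (INR n + 1))).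
    2: { rewrite fact_simpl, mult_INR, S_INR. simpl dfall. field. lra. }
    rewrite Rabs_mult, <- tech_pow_Rmult, (Rmult_comm _ ((1 + Rabs a + Rabs b) ^ n)).
    apply Rmult_le_compat; [apply Rabs_pos|apply Rabs_pos|exact IH|].
    unfold Rdiv. rewrite Rabs_mult, Rabs_inv, (Rabs_right (INR n + 1)) by lra.
    apply (Rmult_le_reg_r (INR n + 1)); [lra|].
    rewrite Rmult_assoc, Rinv_l, Rmult_1_r by lra.
    eapply Rle_trans; [apply Rabs_triang|].
    rewrite Rabs_Ropp, Rabs_mult, (Rabs_right (INR n)) by lra. nra.
Qed.

(** The coefficients satisfy [(n + 1) e_(n+1) + a n e_n = b e_n], so the sum solves
    [(1 + a t) y' = b y] with [y(0) = 1]. *)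
Lemma is_pseries_binomial (a b t : R) :
  a <> 0 -> Rabs t * (1 + Rabs a + Rabs b) < 1 ->
  is_pseries (fun n => dfall a b n / INR (fact n)) t (Rpower (1 + a * t) (b / a)).
Proof.
  intros Ha Ht.
  set (e := fun n => dfall a b n / INR (fact n)).
  set (r := 1 + Rabs a + Rabs b) in *.
  pose proof (Rabs_pos a) as Pa. pose proof (Rabs_pos b) as Pb.
  assert (Hr : 0 < r) by (unfold r; lra).
  assert (Hs : forall s, Rabs s <= Rabs t -> Rabs s * r < 1).
  { intros s Hs. eapply Rle_lt_trans; [|exact Ht].
    apply Rmult_le_compat_r; lra. }
  assert (Hcv : forall s, Rabs s <= Rabs t -> Rbar_lt (Rabs s) (CV_radius e)).
  { intros s H. apply CV_radius_geometric with 1 r;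
      [exact Hr|apply dfall_fact_bound|now apply Hs]. }
  replace (Rpower (1 + a * t) (b / a)) with (PSeries e t).
  - apply PSeries_correct, CV_radius_inside, Hcv; lra.
  - rewrite (affine_ode_unique (PSeries e) (PSeries (PS_derive e)) a b t Ha).
    + rewrite PSeries_0. unfold e. simpl. field.
    + intros s H. apply affine_pos with r; [unfold r; lra|now apply Hs].
    + intros s H. now apply is_derive_PSeries, Hcv.
    + intros s H. rewrite PSeries_affine_derive by now apply Hcv.
      rewrite <- PSeries_scal. apply PSeries_ext. intros n.
      unfold e, PS_scal, scal; simpl; unfold mult; simpl.
      change (match n with 0%nat => 1 | S _ => INR n + 1 end) with (INR (S n)).
      change (fact n + n * fact n)%nat with (fact (S n)).
      rewrite fact_simpl, mult_INR, S_INR.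
      pose proof (pos_INR n). pose proof (INR_fact_neq_0 n). field. lra.
Qed.

(** * Connection coefficients: a recursive solution and its uniqueness *)

(* The recurrence comes from [y (y)_{l,b} = (y)_{l+1,b} + l b (y)_{l,b}]. *)
Fixpoint conn (a b : R) (n l : nat) : R :=
  match n, l with
  | O, O => 1
  | O, S _ => 0
  | S _, O => 0
  | S n, S l => conn a b n l + (INR (S l) * b - INR n * a) * conn a b n (S l)
  end.

Lemma conn_above (a b : R) (n l : nat) : (n < l)%nat -> conn a b n l = 0.
Proof.
  revert l. induction n as [|n IH]; intros [|l] H; try lia; [reflexivity|].
  simpl conn. rewrite !IH by lia. ring.
Qed.

Lemma conn_is_connection (a b : R) : is_connection (dfall a) (dfall b) (conn a b).
Proof.
  split; [|apply conn_above]. intros n x.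
  induction n as [|n IH]; [simpl; ring|].
  rewrite (decomp_sum _ (S n)) by lia.
  simpl pred. simpl dfall at 1. rewrite IH.
  simpl conn at 2. rewrite Rmult_0_l, Rplus_0_l.
  set (c := conn a b) in *.
  (* Each term splits into the one from the induction hypothesis times [x - n a] and a difference of
     consecutive values of [(i b - n a) c(n, i) (x)_{i,b}], which telescopes. *)
  rewrite (sum_eq (fun i => c (S n) (S i) * dfall b x (S i))
    (fun i => c n i * dfall b x i * (x - INR n * a)
      + ((INR (S i) * b - INR n * a) * c n (S i) * dfall b x (S i)
         - (INR i * b - INR n * a) * c n i * dfall b x i))).
  2: { intros i _. unfold c. cbn [conn dfall]. ring. }
  rewrite plus_sum, (Rmult_comm (sum_f_R0 _ n)), scal_sum.
  assert (T : forall m, sum_f_R0 (fun i =>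
     (INR (S i) * b - INR n * a) * c n (S i) * dfall b x (S i)
         - (INR i * b - INR n * a) * c n i * dfall b x i) m
    = (INR (S m) * b - INR n * a) * c n (S m) * dfall b x (S m)
      - (0 - INR n * a) * c n 0%nat).
  { induction m as [|m IHm].
    - simpl. ring.
    - rewrite tech5, IHm. ring. }
  rewrite T.
  assert (Z1 : c n (S n) = 0) by (apply conn_above; lia).
  (* The lower boundary term: [c n 0] is nonzero only when [n = 0], where the factor [INR n]
     vanishes. *)
  assert (Z0 : INR n * c n 0%nat = 0) by (destruct n; unfold c; simpl; ring).
  replace ((0 - INR n * a) * c n 0%nat) with (- a * (INR n * c n 0%nat)) by ring.
  rewrite Z0, Z1. ring.
Qed.

Lemma dfall_eq_0 (b : R) (m l : nat) : (m < l)%nat -> dfall b (INR m * b) l = 0.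
Proof.
  induction l as [|l IH]; [lia|]. intros H. simpl.
  destruct (Nat.eq_dec m l) as [->|Hn]; [ring|].
  rewrite IH by lia. ring.
Qed.

Lemma dfall_neq_0 (b : R) (m l : nat) : b <> 0 -> (l <= m)%nat -> dfall b (INR m * b) l <> 0.
Proof.
  intros Hb. induction l as [|l IH]; intros H; simpl; [lra|].
  apply Rmult_integral_contrapositive; split; [apply IH; lia|].
  rewrite <- Rmult_minus_distr_r, <- minus_INR by lia.
  apply Rmult_integral_contrapositive; split; [apply not_0_INR; lia|exact Hb].
Qed.

(* At [x = l b] the terms of index above [l] vanish, so the values at
   [0, b, 2 b, ...] form a triangular system. *)
Lemma dfall_independent (b : R) (d : nat -> R) (n : nat) :
  b <> 0 -> (forall x, sum_f_R0 (fun l => d l * dfall b x l) n = 0) ->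
  forall l, (l <= n)%nat -> d l = 0.
Proof.
  intros Hb H l. induction l as [l IH] using lt_wf_ind. intros Hl.
  specialize (H (INR l * b)).
  assert (E : forall m, (l <= m)%nat ->
    sum_f_R0 (fun i => d i * dfall b (INR l * b) i) m = d l * dfall b (INR l * b) l).
  { induction m as [|m IHm]; intros Hm.
    - replace l with 0%nat by lia. reflexivity.
    - rewrite tech5. destruct (Nat.eq_dec l (S m)) as [Em|Hn].
      + rewrite sum_f_R0_zero; [rewrite Em; ring|].
        intros i Hi. rewrite IH by lia. ring.
      + rewrite IHm, (dfall_eq_0 b l (S m)) by lia. ring. }
  rewrite (E n Hl) in H.
  apply Rmult_integral in H. destruct H as [H|H]; [exact H|].
  now apply dfall_neq_0 in H.
Qed.

(** [conn] shows that a connection array exists, so the one chosen by [epsilon] is valid;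
    independence of the [(x)_{l,b}] gives agreement for [l <= n], and both vanish above the
    diagonal. *)
Lemma connection_eq (a b : R) (n l : nat) :
  b <> 0 -> connection (dfall a) (dfall b) n l = conn a b n l.
Proof.
  intros Hb.
  assert (Hc : is_connection (dfall a) (dfall b) (connection (dfall a) (dfall b))).
  { unfold connection. apply epsilon_spec. exists (conn a b). apply conn_is_connection. }
  destruct Hc as [Hs Ha]. destruct (conn_is_connection a b) as [Hs' _].
  destruct (le_lt_dec l n) as [Hl|Hl]; [|now rewrite Ha, conn_above].
  apply Rminus_diag_uniq.
  apply (dfall_independent b
    (fun l => connection (dfall a) (dfall b) n l - conn a b n l) n Hb); [|exact Hl].
  intros x.
  rewrite (sum_eq _ (fun l => connection (dfall a) (dfall b) n l * dfall b x l
                              - conn a b n l * dfall b x l)) by (intros; ring).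
  rewrite minus_sum, <- Hs, <- Hs'. ring.
Qed.

(** * Power series of the powers of [g = ((1 + a t)^(b/a) - 1) / b] *)

(* Taylor coefficients of [(((1 + a t)^(b/a) - 1) / b)^k]. *)
Definition conn_coef (a b : R) (k n : nat) : R :=
  INR (fact k) * conn a b n k / INR (fact n).

Lemma conn_coef_above (a b : R) (k n : nat) : (n < k)%nat -> conn_coef a b k n = 0.
Proof.
  intros H. unfold conn_coef. rewrite conn_above by exact H. unfold Rdiv. ring.
Qed.

(** Coefficient form of [(1 + a t) (g^(k+1))' = (k+1) (g^k + b g^(k+1))]. *)
Lemma conn_coef_S (a b : R) (k n : nat) :
  INR (S n) * conn_coef a b (S k) (S n)
  = INR (S k) * conn_coef a b k n
    + (INR (S k) * b - INR n * a) * conn_coef a b (S k) n.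
Proof.
  unfold conn_coef. cbn [conn]. rewrite !fact_simpl, !mult_INR.
  pose proof (INR_fact_neq_0 n). pose proof (not_0_INR (S n) (Nat.neq_succ_0 n)).
  field. now split.
Qed.

(** [M] is free: a small [M] lets [M ^ k] beat the growth of the outer coefficients in a
    substitution, at the cost of a larger rate in [n]. In the recurrence, [k <= n] (otherwise the
    coefficient is 0) bounds all integer factors by [n + 1], which cancels. *)
Lemma conn_coef_bound (a b M : R) (k n : nat) : 0 < M ->
  Rabs (conn_coef a b k n) <= M ^ k * (/ M + Rabs a + Rabs b) ^ n.
Proof.
  intros HM. set (Q := / M + Rabs a + Rabs b).
  pose proof (Rabs_pos a) as Pa. pose proof (Rabs_pos b) as Pb.
  assert (HiM : 0 < / M) by now apply Rinv_0_lt_compat.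
  assert (HQ : 0 < Q) by (unfold Q; lra).
  assert (Hnn : forall k n, 0 <= M ^ k * Q ^ n).
  { intros. apply Rmult_le_pos; apply pow_le; lra. }
  revert k. induction n as [|n IH]; intros [|k].
  - unfold conn_coef. simpl. rewrite Rdiv_1_r, !Rmult_1_r, Rabs_R1. lra.
  - rewrite conn_coef_above by lia. rewrite Rabs_R0. apply Hnn.
  - unfold conn_coef. simpl conn. unfold Rdiv. rewrite Rmult_0_r, Rmult_0_l, Rabs_R0. apply Hnn.
  - destruct (le_lt_dec (S k) (S n)) as [Hk|Hk].
    2: { rewrite conn_coef_above by lia. rewrite Rabs_R0. apply Hnn. }
    assert (Hn0 : 0 < INR (S n)) by (apply lt_0_INR; lia).
    assert (Hkn : INR (S k) <= INR (S n)) by now apply le_INR.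
    assert (Hn : 0 <= INR n <= INR (S n)) by (rewrite S_INR; pose proof (pos_INR n); lra).
    apply (Rmult_le_reg_l (INR (S n))); [exact Hn0|].
    rewrite <- (Rabs_right (INR (S n))) at 1 by lra.
    rewrite <- Rabs_mult, conn_coef_S.
    eapply Rle_trans; [apply Rabs_triang|]. rewrite !Rabs_mult.
    rewrite (Rabs_right (INR (S k))) by (apply Rle_ge, pos_INR).
    apply Rle_trans with (INR (S n) * (M ^ k * Q ^ n)
        + INR (S n) * (Rabs a + Rabs b) * (M ^ S k * Q ^ n)).
    + apply Rplus_le_compat.
      * apply Rmult_le_compat; [apply pos_INR|apply Rabs_pos|exact Hkn|apply IH].
      * apply Rmult_le_compat; [apply Rabs_pos|apply Rabs_pos| |apply IH].
        eapply Rle_trans; [apply Rabs_triang|].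
        rewrite Rabs_Ropp, !Rabs_mult.
        rewrite (Rabs_right (INR (S k))) by (apply Rle_ge, pos_INR).
        rewrite (Rabs_right (INR n)) by lra. nra.
    + apply Req_le. rewrite <- !tech_pow_Rmult. unfold Q at 3. field. lra.
Qed.

(** Induction on [k]: the series for exponent [k + 1] and [g^(k+1)] solve the same linear equation,
    whose inhomogeneous term [(k+1) g^k] is known from the previous exponent, and both vanish at
    0. *)
Lemma is_pseries_conn_coef (a b t : R) (k : nat) :
  a <> 0 -> b <> 0 -> Rabs t * (1 + Rabs a + Rabs b) < 1 ->
  is_pseries (conn_coef a b k) t (((Rpower (1 + a * t) (b / a) - 1) / b) ^ k).
Proof.
  intros Ha Hb.
  set (r := 1 + Rabs a + Rabs b).
  pose proof (Rabs_pos a) as Pa. pose proof (Rabs_pos b) as Pb.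
  assert (Hr : 0 < r) by (unfold r; lra).
  assert (Hcv : forall k s, Rabs s * r < 1 -> Rbar_lt (Rabs s) (CV_radius (conn_coef a b k))).
  { intros j s H. apply CV_radius_geometric with 1 r; [exact Hr| |exact H].
    intros n. pose proof (conn_coef_bound a b 1 j n Rlt_0_1) as B.
    rewrite pow1, Rinv_1 in B. exact B. }
  revert t. induction k as [|k IH]; intros t Ht.
  (* For [k = 0] the coefficients are 1, 0, 0, ..., the binomial series with exponent 0. *)
  - apply (is_pseries_ext (fun n => dfall a 0 n / INR (fact n))).
    + intros n. unfold conn_coef. destruct n as [|n]; [simpl; field|].
      cbn [conn]. replace 0 with (INR 0 * a) at 1 by (simpl; ring).
      rewrite dfall_eq_0 by lia. now rewrite Rmult_0_r.
    + replace (((Rpower (1 + a * t) (b / a) - 1) / b) ^ 0)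
        with (Rpower (1 + a * t) (0 / a)).
      * apply is_pseries_binomial; [exact Ha|].
        eapply Rle_lt_trans; [|exact Ht].
        apply Rmult_le_compat_l; [apply Rabs_pos|]. rewrite Rabs_R0. unfold r. lra.
      * unfold Rdiv. rewrite Rmult_0_l, Rpower_O; [reflexivity|].
        apply affine_pos with r; [unfold r; lra|exact Ht].
  - set (g := fun s => (Rpower (1 + a * s) (b / a) - 1) / b) in *.
    change (is_pseries (conn_coef a b (S k)) t (g t ^ S k)).
    assert (Hs : forall s, Rabs s <= Rabs t -> Rabs s * r < 1).
    { intros s Hs. eapply Rle_lt_trans; [|exact Ht].
      apply Rmult_le_compat_r; lra. }
    assert (Hpos : forall s, Rabs s <= Rabs t -> 0 < 1 + a * s).
    { intros s H. apply affine_pos with r; [unfold r; lra|now apply Hs]. }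
    set (g' := fun s => Rpower (1 + a * s) (b / a) / (1 + a * s)).
    assert (Hg : forall s, Rabs s <= Rabs t -> is_derive g s (g' s)).
    { intros s H. specialize (Hpos s H). unfold g, g', Rpower.
      auto_derive; [lra|]. field. lra. }
    set (P := PSeries (conn_coef a b (S k))).
    replace (g t ^ S k) with (P t).
    { apply PSeries_correct, CV_radius_inside, Hcv, Ht. }
    apply Rminus_diag_uniq.
    (* In the difference the inhomogeneous terms cancel, leaving [(1 + a s) y' = (k+1) b y] with
       initial value 0. *)
    rewrite (affine_ode_unique (fun s => P s - g s ^ S k)
      (fun s => PSeries (PS_derive (conn_coef a b (S k))) s - INR (S k) * g' s * g s ^ k)
      a (INR (S k) * b) t Ha Hpos).
    + unfold P. rewrite PSeries_0. unfold g.
      rewrite conn_coef_above, Rmult_0_r, Rplus_0_r, Rpower_base_1 by lia.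
      simpl. unfold Rdiv. ring.
    + intros s H. apply (is_derive_minus (K := R_AbsRing) (V := R_NormedModule)).
      * apply is_derive_PSeries, Hcv, Hs, H.
      * apply (is_derive_pow g (S k) s (g' s)), Hg, H.
    + intros s H. rewrite Rmult_minus_distr_l, PSeries_affine_derive by (apply Hcv, Hs, H).
      rewrite (PSeries_ext _ (PS_plus (PS_scal (INR (S k)) (conn_coef a b k))
         (PS_scal (INR (S k) * b) (conn_coef a b (S k))))).
      2: { intros n. rewrite conn_coef_S.
           unfold PS_plus, PS_scal, plus, scal; simpl; unfold mult; simpl. ring. }
      rewrite PSeries_plus, !PSeries_scal.
      2, 3: apply ex_pseries_scal; [apply Rmult_comm|apply CV_radius_inside, Hcv, Hs, H].
      rewrite (is_pseries_unique _ _ _ (IH s (Hs s H))). fold P.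
      change ((Rpower (1 + a * s) (b / a) - 1) / b) with (g s).
      (* Uses [(1 + a s) g' = (1 + a s)^(b/a) = 1 + b g]. *)
      replace ((1 + a * s) * (INR (S k) * g' s * g s ^ k))
        with (INR (S k) * (1 + b * g s) * g s ^ k).
      2: { unfold g' at 1. specialize (Hpos s H).
           replace (1 + b * g s) with (Rpower (1 + a * s) (b / a)) by (unfold g; field; exact Hb).
           field. lra. }
      rewrite <- tech_pow_Rmult. ring.
Qed.

(** * Substitution of [u = e_lam(t) - 1] *)

Lemma locally_0_small (d : R) : 0 < d -> locally 0 (fun t => Rabs t < d).
Proof.
  intros Hd. exists (mkposreal d Hd). intros t Ht.
  unfold ball in Ht; simpl in Ht; unfold AbsRing_ball, abs, minus, plus, opp in Ht;
    simpl in Ht.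
  now rewrite Ropp_0, Rplus_0_r in Ht.
Qed.

Lemma dexp_small (lam d : R) : 0 < d -> locally 0 (fun t => Rabs (dexp lam t - 1) < d).
Proof.
  intros Hd.
  assert (H0 : 0 < 1 + lam * 0) by lra.
  pose proof (is_derive_Rpower_affine lam (1 / lam) 0 H0) as D.
  assert (C : continuous (dexp lam) 0) by (apply (ex_derive_continuous (dexp lam)); eexists; exact D).
  unfold continuous in C.
  pose proof (proj1 (filterlim_locally _ _) C (mkposreal d Hd)) as L.
  revert L. apply filter_imp. intros t Ht.
  unfold dexp in Ht at 1. rewrite Rmult_0_r, Rplus_0_r, Rpower_base_1 in Ht. exact Ht.
Qed.

Lemma locally'_of_locally (P : R -> Prop) : locally 0 P -> locally' 0 P.
Proof. apply filter_le_within. Qed.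

(** Common to both formulas: an expansion of [f] in powers of [u] becomes one in [t], since [u^l]
    has coefficients [conn_coef lam 1 l], that is [l! S2(n,l) / n!]. *)
Lemma egf_coef_comp (lam : R) (a : nat -> R) (A r : R) (f : R -> R) (n : nat) :
  lam <> 0 -> 0 < r -> (forall l, Rabs (a l) <= A * r ^ l) ->
  locally' 0 (fun t => is_pseries a (dexp lam t - 1) (f t)) ->
  egf_coef f n = sum_f_R0 (fun l => a l * INR (fact l) * S2 lam n l) n.
Proof.
  intros Hlam Hr Ha Hf.
  apply (egf_coef_eq f
    (fun n => sum_f_R0 (fun l => a l * INR (fact l) * S2 lam n l) n)).
  clear n. unfold is_egf.
  (* This [M] gives [r * M = 1 / 2], as the substitution requires; [Q] is the matching rate from
     [conn_coef_bound]. *)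
  set (M := / (2 * r)). set (Q := / M + Rabs lam + Rabs 1).
  assert (HM : 0 < M) by (apply Rinv_0_lt_compat; lra).
  pose proof (Rabs_pos lam) as Pl. pose proof (Rabs_pos 1) as P1.
  assert (HQ : 0 < Q).
  { unfold Q. assert (0 < / M) by now apply Rinv_0_lt_compat. lra. }
  assert (H1 : 0 < 1 + Rabs lam + Rabs 1) by lra.
  pose proof (locally'_of_locally _ (locally_0_small _ (Rinv_0_lt_compat _ HQ))) as LQ.
  pose proof (locally'_of_locally _ (locally_0_small _ (Rinv_0_lt_compat _ H1))) as L1.
  generalize (filter_and _ _ Hf (filter_and _ _ LQ L1)).
  apply filter_imp. intros t [Hs [HtQ Ht1]].
  apply (is_pseries_ext (fun n => sum_f_R0 (fun l => a l * conn_coef lam 1 l n) n)).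
  { intros n. unfold Rdiv. rewrite (Rmult_comm (sum_f_R0 _ n)), scal_sum.
    apply sum_eq. intros l _. unfold S2. rewrite connection_eq by lra.
    unfold conn_coef, Rdiv. ring. }
  assert (E : forall x, 0 < x -> Rabs t < / x -> Rabs t * x < 1).
  { intros x Hx Hlt. apply (Rmult_lt_compat_r x) in Hlt; [|exact Hx].
    rewrite Rinv_l in Hlt; lra. }
  apply is_pseries_comp with A r M Q (dexp lam t - 1); auto.
  - unfold M. apply Req_le. field. lra.
  - intros l n. apply conn_coef_bound, HM.
  - intros l n. apply conn_coef_above.
  - intros l. replace (dexp lam t - 1) with ((Rpower (1 + lam * t) (1 / lam) - 1) / 1)
      by (unfold dexp; field; exact Hlam).
    apply is_pseries_conn_coef; [exact Hlam|lra|now apply E].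
Qed.

(** * The two outer series in [u] and the resulting formulas *)

Lemma dfall_succ_1 (x : R) (l : nat) : dfall 1 (x + 1) (S l) = (x + 1) * dfall 1 x l.
Proof.
  induction l as [|l IH]; [simpl; ring|].
  change (dfall 1 (x + 1) (S (S l)))
    with (dfall 1 (x + 1) (S l) * (x + 1 - INR (S l) * 1)).
  rewrite IH, S_INR. simpl. ring.
Qed.

(** The falling factorial on the left is the rising product [x (x+1) ... (x+l-1)]; multiplying each
    factor by [-c] gives a falling factorial of step [c]. *)
Lemma dfall_rising (c x : R) (l : nat) :
  (- c) ^ l * dfall 1 (x + INR l - 1) l = dfall c (- (c * x)) l.
Proof.
  induction l as [|l IH]; [simpl; ring|].
  replace (x + INR (S l) - 1) with (x + INR l - 1 + 1) by (rewrite S_INR; ring).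
  rewrite dfall_succ_1. simpl dfall. rewrite <- IH. simpl pow. ring.
Qed.

(** Inverting gives [t = ((1 + u)^lam - 1) / lam], so [t^k] has coefficients [conn_coef 1 lam k] in
    [u]; dividing by [u^k] shifts them by [k]. *)
Lemma is_pseries_bernoulli (lam t : R) (k : nat) :
  lam <> 0 -> t <> 0 -> 0 < 1 + lam * t ->
  Rabs (dexp lam t - 1) * (1 + Rabs 1 + Rabs lam) < 1 ->
  is_pseries (fun l => conn_coef 1 lam k (l + k)) (dexp lam t - 1)
    ((t / (dexp lam t - 1)) ^ k).
Proof.
  intros Hlam Ht Hpos Hu. set (u := dexp lam t - 1) in *.
  assert (Hinv : (Rpower (1 + 1 * u) (lam / 1) - 1) / lam = t).
  { replace (1 + 1 * u) with (dexp lam t) by (unfold u; ring).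
    unfold dexp. rewrite Rpower_mult.
    replace (1 / lam * (lam / 1)) with 1 by (field; exact Hlam).
    rewrite Rpower_1 by exact Hpos. field. exact Hlam. }
  assert (Hu0 : u <> 0).
  { intros E. apply Ht. rewrite <- Hinv, E, Rmult_0_r, Rplus_0_r, Rpower_base_1.
    field. exact Hlam. }
  replace ((t / u) ^ k) with (t ^ k / u ^ k)
    by (unfold Rdiv; rewrite Rpow_mult_distr, pow_inv; reflexivity).
  apply is_pseries_shift; [exact Hu0|intros n; apply conn_coef_above|].
  rewrite <- Hinv.
  apply is_pseries_conn_coef; [lra|exact Hlam|exact Hu].
Qed.

(** The function is [(1 + u/2)^(-alpha)]: the binomial series with [a = 1/2] and [b = -alpha/2], so
    that [b/a = -alpha]. *)
Lemma is_pseries_euler (u alpha : R) :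
  Rabs u * (1 + Rabs (1 / 2) + Rabs (- (1 / 2 * alpha))) < 1 ->
  is_pseries (fun l => dfall (1 / 2) (- (1 / 2 * alpha)) l / INR (fact l)) u
    (Rpower (2 / (u + 2)) alpha).
Proof.
  intros Hu.
  pose proof (Rabs_pos (1 / 2)). pose proof (Rabs_pos (- (1 / 2 * alpha))).
  assert (Hpos : 0 < 1 + 1 / 2 * u) by (eapply affine_pos; [|exact Hu]; lra).
  replace (Rpower (2 / (u + 2)) alpha)
    with (Rpower (1 + 1 / 2 * u) (- (1 / 2 * alpha) / (1 / 2))).
  - apply is_pseries_binomial; [lra|exact Hu].
  - replace (2 / (u + 2)) with (/ (1 + 1 / 2 * u)) by (field; lra).
    unfold Rpower. rewrite ln_Rinv by exact Hpos. f_equal. field.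
Qed.

Theorem theorem27 (lam : R) (hlam : lam <> 0) (k : nat) (alpha : R) (n : nat) :
  dbernoulli lam k n =
    sum_f_R0 (fun l => / Binomial.C (l + k) k * S1 lam (l + k) k * S2 lam n l) n
  /\
  deuler lam alpha n =
    sum_f_R0 (fun l => (- (1 / 2)) ^ l * gbinom (alpha + INR l - 1) l
                       * INR (fact l) * S2 lam n l) n.
Proof.
  assert (Small : forall d c, 0 < d -> Rabs c < / d -> Rabs c * d < 1).
  { intros d c Hd Hc. apply (Rmult_lt_compat_r d) in Hc; [|exact Hd].
    rewrite Rinv_l in Hc; lra. }
  pose proof (Rabs_pos lam) as Pl.
  split.
  - set (r := 1 + Rabs 1 + Rabs lam).
    assert (Hr : 0 < r) by (unfold r; rewrite Rabs_R1; lra).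
    unfold dbernoulli.
    (* The constant [r ^ k] absorbs the index shift: the bound at [l + k] is [r ^ k * r ^ l]. *)
    rewrite (egf_coef_comp lam (fun l => conn_coef 1 lam k (l + k)) (r ^ k) r);
      [|exact hlam|exact Hr| |].
    + apply sum_eq. intros l _. unfold S1. rewrite connection_eq by exact hlam.
      unfold conn_coef, Binomial.C. rewrite Nat.add_sub.
      pose proof (INR_fact_neq_0 l). pose proof (INR_fact_neq_0 k).
      pose proof (INR_fact_neq_0 (l + k)). field. auto.
    + intros l. pose proof (conn_coef_bound 1 lam 1 k (l + k) Rlt_0_1) as B.
      rewrite pow1, Rinv_1, Rmult_1_l in B. fold r in B.
      rewrite <- pow_add, Nat.add_comm. rewrite Nat.add_comm in B. exact B.
    + pose proof (dexp_small lam _ (Rinv_0_lt_compat _ Hr)) as L1.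
      pose proof (locally_0_small _ (Rinv_0_lt_compat _ Hr)) as L2.
      unfold locally', within.
      generalize (filter_and _ _ L1 L2). apply filter_imp.
      intros t [H1 H2] Ht. apply is_pseries_bernoulli; auto.
      apply affine_pos with r; [unfold r; rewrite Rabs_R1; lra|auto].
  - set (r := 1 + Rabs (1 / 2) + Rabs (- (1 / 2 * alpha))).
    pose proof (Rabs_pos (1 / 2)). pose proof (Rabs_pos (- (1 / 2 * alpha))).
    assert (Hr : 0 < r) by (unfold r; lra).
    unfold deuler.
    rewrite (egf_coef_comp lam
      (fun l => dfall (1 / 2) (- (1 / 2 * alpha)) l / INR (fact l)) 1 r);
      [|exact hlam|exact Hr| |].
    (* With [c = 1/2], [dfall_rising] turns the binomial-series coefficient into [(-1/2)^l] times
       the generalized binomial coefficient. *)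
    + apply sum_eq. intros l _. unfold gbinom. rewrite <- dfall_rising.
      pose proof (INR_fact_neq_0 l). field. auto.
    + apply dfall_fact_bound.
    + apply locally'_of_locally. generalize (dexp_small lam _ (Rinv_0_lt_compat _ Hr)).
      apply filter_imp. intros t Ht.
      replace (dexp lam t + 1) with (dexp lam t - 1 + 2) by ring.
      apply is_pseries_euler. auto.
Qed.
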